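(* Let $k \geq 2$ be an integer, let $\ell = ax + by \in \mathbb{C}[x,y]$ be a linear form, and for $\lambda \in \mathbb{C}\setminus\{0\}$ let $f_\lambda = x^k y^k + \lambda \ell^{2k}$. Then: \begin{itemize} \item if $ab \neq 0$, there is a unique $\lambda_0 \in \mathbb{C}\setminus\{0\}$ such that $\mathrm{R}(f_\lambda) = k$ if $\lambda = \lambda_0$ and $\mathrm{R}(f_\lambda) = k+1$ if $\lambda \neq \lambda_0$; \item if $ab = 0$, then $\mathrm{R}(f_\lambda) = k+1$ for every $\lambda \neq 0$. \end{itemize}
   Context: For a homogeneous polynomial $f \in \mathbb{C}[x,y]$ of degree $d$, the Waring rank $\mathrm{R}(f)$ is the smallest $r$ such that $f = \ell_1^d + \cdots + \ell_r^d$ for some linear forms $\ell_1,\dots,\ell_r \in \mathbb{C}[x,y]$. *)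

(* Defs.v *)
From HB Require Import structures.
From mathcomp Require Import all_boot all_order all_algebra.
From mathcomp Require Import reals.
From mathcomp Require Import complex.
From mathcomp Require Import mpoly.

Set Implicit Arguments.
Unset Strict Implicit.
Unset Printing Implicit Defensive.

Import GRing.Theory.

Local Open Scope ring_scope.

(* The coefficient field is left abstract; [F := R[i]] with [R : realType]
   gives the complex numbers. *)
Section WaringRank.
Variables (F : fieldType) (n : nat).
Implicit Types (f : {mpoly F[n]}) (d r : nat).

(* In [multinomials], [0] is homogeneous of every degree, so the zero form is
   allowed as a summand. *)
Definition has_waring_decomposition d f r : Prop :=
  exists l : 'I_r -> {mpoly F[n]},
    (forall i, l i \is 1.-homog) /\ f = \sum_(i < r) l i ^+ d.

(* R(f) = r for a form [f] of degree [d]; the degree is an explicit argument. *)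
Definition has_waring_rank d f r : Prop :=
  has_waring_decomposition d f r /\
  forall s, has_waring_decomposition d f s -> (r <= s)%N.

End WaringRank.

Section BinaryForms.
Variable F : fieldType.

Definition binary_x : {mpoly F[2]} := 'X_0.
Definition binary_y : {mpoly F[2]} := 'X_1.

Definition linear_form (a b : F) : {mpoly F[2]} :=
  a *: binary_x + b *: binary_y.

Definition f_lambda (k : nat) (a b lambda : F) : {mpoly F[2]} :=
  binary_x ^+ k * binary_y ^+ k + lambda *: linear_form a b ^+ (2 * k).

End BinaryForms.

(* Main.v *)
(* Let C = binomial (2k) k and c = (k+1) C (ab)^k.

   If s <= k powers of linear forms sum to f_lambda, then some nonzero form g
   of degree k vanishes at all the s corresponding points, so it is apolar to
   f_lambda.  Comparing coefficients, g_j = - C lambda a^(k-j) b^j g(a, b);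
   evaluating at (a, b) gives - lambda c = 1.  If s < k, then g may also be
   required to satisfy g_0 = 0, which contradicts g_0 = - C lambda a^k g(a, b).

   If ab <> 0 and z is a primitive (k+1)-st root of unity, then
   sum_i z^i (z^i a x + b y)^(2k) = c x^k y^k: adding lambda l^(2k) only changes
   the term i = 0, and cancels it when lambda = - 1/c.  If l is a multiple of x,
   use instead a primitive k-th root of unity z and
   sum_i (z^i s x + y)^(2k) = k (y^(2k) + C s^k x^k y^k + s^(2k) x^(2k)). *)

Require Import Defs.
From HB Require Import structures.
From mathcomp Require Import all_boot all_order all_algebra.
From mathcomp Require Import reals.
From mathcomp Require Import complex.
From mathcomp Require Import mpoly.
From mathcomp Require Import cyclic separable cyclotomic ring zify.

Set Implicit Arguments.
Unset Strict Implicit.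
Unset Printing Implicit Defensive.

Import GRing.Theory.

Local Open Scope ring_scope.

(** * Lower bounds on the rank by apolarity *)

Section LowerBound.
Import Num.Theory.
Variable F : numFieldType.
Implicit Types (a b lambda : F) (k s : nat).

Lemma mid_binomial_neq0 k : 'C(2 * k, k)%:R != 0 :> F.
Proof.
by rewrite pnatr_eq0 -lt0n bin_gt0 mul2n -addnn leq_addr.
Qed.

Lemma dhomog1_linear_form (l : {mpoly F[2]}) :
  l \is 1.-homog -> l = linear_form l@_U_(0) l@_U_(1).
Proof.
move=> hl; apply/mpolyP => m.
rewrite /linear_form /binary_x /binary_y mcoeffD !mcoeffZ !mcoeffX.
have [/mdeg1P[i /eqP->]|m1] := boolP (mdeg m == 1%N); last first.
  rewrite (dhomog_nemf_coeff hl) //.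
  have ne i : (U_(i)%MM == m) = false.
    by apply: contraNF m1 => /eqP <-; rewrite mdeg1.
  by rewrite !ne !mulr0 addr0.
rewrite !eq_mnm1; case: i => -[|[|//]] hi.
- have -> : Ordinal hi = 0 by apply: val_inj.
  by rewrite eqxx mulr1 mulr0 addr0.
- have -> : Ordinal hi = 1 by apply: val_inj.
  by rewrite eqxx mulr1 mulr0 add0r.
Qed.

(** Setting [y = 1] loses nothing on forms of a known degree and lets their coefficients be read off
    as those of a univariate polynomial. *)
Local Notation dehomogenize :=
  (mmap (@polyC F) (fun i : 'I_2 => if i == 0 then 'X else 1)).

Lemma dehomogenize_linear_form (u v : F) :
  dehomogenize (linear_form u v) = u *: 'X + v%:P.
Proof.
rewrite /linear_form mmapD !mmapZ !mmapX !mmap1U /=.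
by rewrite mulr1 mul_polyC.
Qed.

Lemma coef_linear_exp (u v : F) d j : (j <= d)%N ->
  ((u *: 'X + v%:P) ^+ d)`_j = (u ^+ j * v ^+ (d - j)) *+ 'C(d, j).
Proof.
move=> hj; rewrite addrC exprDn coef_sum (bigD1 (inord j)) //= inordK ?ltnS //.
rewrite coefMn exprZn -polyC_exp coefCM coefZ coefXn eqxx mulr1 mulrC.
rewrite big1 ?addr0 // => i ne_ij.
rewrite coefMn exprZn -polyC_exp coefCM coefZ coefXn.
case: eqP => [ij|_]; last by rewrite !mulr0 mul0rn.
by case/eqP: ne_ij; apply: val_inj; rewrite /= inordK ?ltnS.
Qed.

(** Compare the coefficients of [x^j y^(2k-j)] and divide by ['C(2 * k, j)], which is nonzero in
    characteristic 0. The binomial survives only at [j = k], the exponent of the monomial. *)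
Lemma waring_moments k a b lambda s :
  has_waring_decomposition (2 * k) (f_lambda k a b lambda) s ->
  exists u v : 'I_s -> F, forall j, (j <= 2 * k)%N ->
    (j == k)%:R / 'C(2 * k, k)%:R + lambda * (a ^+ j * b ^+ (2 * k - j)) =
    \sum_(i < s) u i ^+ j * v i ^+ (2 * k - j).
Proof.
case=> l [hl def_f].
exists (fun i => (l i)@_U_(0)), (fun i => (l i)@_U_(1)) => j hj.
have nzC n m : (m <= n)%N -> 'C(n, m)%:R != 0 :> F.
  by move=> le_mn; rewrite pnatr_eq0 -lt0n bin_gt0.
have := congr1 (fun f => (dehomogenize f)`_j) def_f.
rewrite /f_lambda rmorphD rmorphM !rmorphXn /= mmapZ rmorphXn /=.
rewrite dehomogenize_linear_form !mmapX !mmap1U /= expr1n mulr1.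
rewrite coefD coefXn mul_polyC coefZ coef_linear_exp // rmorph_sum coef_sum /=.
under eq_bigr => i _.
  rewrite rmorphXn /= (dhomog1_linear_form (hl i)) dehomogenize_linear_form.
  rewrite coef_linear_exp //; over.
rewrite sumrMnl => eq_j; apply: (mulIf (nzC _ _ hj)).
rewrite !mulr_natr -eq_j mulrnDl; congr (_ + _); last by rewrite mulrnAr.
have [->|_] := eqVneq j k; last by rewrite mul0r mul0rn.
by rewrite -mulrnAl -mulr_natr mul1r divff // mid_binomial_neq0.
Qed.

Lemma exists_left_kernel m n (M : 'M[F]_(m, n)) : (n < m)%N ->
  exists2 g : 'rV_m, g != 0 & g *m M = 0.
Proof.
move=> lt_nm; have : kermx M != 0.
  by rewrite kermx_eq0 /row_free neq_ltn (leq_ltn_trans (rank_leq_col M)).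
by case/rowV0Pn => g /sub_kermxP gM0 g0; exists g.
Qed.

(* [g] holds the coefficients of a degree-[k] form apolar to [f_lambda]. *)
Lemma apolar_coef k a b lambda s (u v : 'I_s -> F) (g : 'rV[F]_k.+1) :
  (forall j, (j <= 2 * k)%N ->
    (j == k)%:R / 'C(2 * k, k)%:R + lambda * (a ^+ j * b ^+ (2 * k - j)) =
    \sum_(i < s) u i ^+ j * v i ^+ (2 * k - j)) ->
  (forall i, \sum_(j < k.+1) g 0 j * (u i ^+ j * v i ^+ (k - j)) = 0) ->
  forall j : 'I_k.+1, g 0 j =
    - ('C(2 * k, k)%:R * lambda * (a ^+ (k - j) * b ^+ j)) *
    \sum_(i < k.+1) g 0 i * (a ^+ i * b ^+ (k - i)).
Proof.
move=> moments gM0 j; set C : F := 'C(2 * k, k)%:R.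
have nzC : C != 0 by apply: mid_binomial_neq0.
have le_jk : (j <= k)%N by rewrite -ltnS.
(* Pair [g] with the moments of index [i + (k - j)]: the monomial contributes at [i = j] only, and
   each power contributes a multiple of [g(u i, v i)], which is zero. *)
have eq0 : \sum_(i < k.+1) g 0 i * (((i + (k - j))%N == k)%:R / C +
    lambda * (a ^+ (i + (k - j)) * b ^+ (2 * k - (i + (k - j))))) = 0.
  under eq_bigr => i _.
    rewrite moments; last by have := ltn_ord i; lia.
    rewrite mulr_sumr; over.
  rewrite exchange_big /= big1 // => i _.
  transitivity (u i ^+ (k - j) * v i ^+ j *
      \sum_(i0 < k.+1) g 0 i0 * (u i ^+ i0 * v i ^+ (k - i0))).
    rewrite mulr_sumr; apply: eq_bigr => h _.
    have -> : (2 * k - (h + (k - j)) = j + (k - h))%N.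
      by have := ltn_ord h; lia.
    by rewrite !exprD; ring.
  by rewrite gM0 mulr0.
set t := \sum_(i < _) _; apply: (mulIf (invr_neq0 nzC)); apply/eqP; rewrite -subr_eq0 -{}eq0; apply/eqP.
under [RHS]eq_bigr => i _ do rewrite mulrDr.
rewrite big_split /= (bigD1 j) //= subnKC // eqxx mul1r.
rewrite [\sum_(i < _ | _) _]big1 ?addr0 => [|i ne_ij]; last first.
  have -> : (i + (k - j) == k)%N = false.
    by apply: contraNF ne_ij => /eqP e; apply/eqP/val_inj => /=; lia.
  by rewrite mul0r mulr0.
congr (_ + _); rewrite /t mulr_sumr mulr_suml -sumrN.
apply: eq_bigr => i _.
have -> : (2 * k - (i + (k - j)) = j + (k - i))%N by have := ltn_ord i; lia.
rewrite !exprD; field.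
by [].
Qed.

(** Substituting the formula for the coefficients into [g(a, b)] gives [k.+1] equal terms, each a
    multiple of [g(a, b)]. This value can be cancelled: were it zero, all coefficients would
    vanish. *)
Lemma apolar_eigenvalue k a b lambda (g : 'rV[F]_k.+1) :
  g != 0 ->
  (forall j : 'I_k.+1, g 0 j =
    - ('C(2 * k, k)%:R * lambda * (a ^+ (k - j) * b ^+ j)) *
    \sum_(i < k.+1) g 0 i * (a ^+ i * b ^+ (k - i))) ->
  - lambda * (k.+1%:R * 'C(2 * k, k)%:R * (a * b) ^+ k) = 1.
Proof.
move=> g0 gE; set C : F := _%:R in gE *; set t := \sum_(i < _) _ in gE.
have t0 : t != 0.
  apply: contraNneq g0 => t0; apply/eqP/rowP => j.
  by rewrite mxE gE t0 mulr0.
apply: (mulIf t0); rewrite mul1r {2}/t.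
transitivity (\sum_(i < k.+1) - (C * lambda) * (a * b) ^+ k * t).
  by rewrite sumr_const card_ord -mulr_natl; ring.
apply: eq_bigr => i _; rewrite gE exprMn.
have le_ik : (i <= k)%N by rewrite -ltnS.
rewrite -{1 2}(subnK le_ik) !exprD; ring.
Qed.

(** Vanishing at [s] points imposes [s] linear conditions on [k.+1] coefficients, so a nonzero
    apolar [g] exists. *)
Lemma waring_decomposition_eigenvalue k a b lambda s : (s <= k)%N ->
  has_waring_decomposition (2 * k) (f_lambda k a b lambda) s ->
  - lambda * (k.+1%:R * 'C(2 * k, k)%:R * (a * b) ^+ k) = 1.
Proof.
move=> le_sk /waring_moments[u [v moments]].
pose M : 'M_(k.+1, s) := \matrix_(j, i) (u i ^+ j * v i ^+ (k - j)).
have [//|g g0 gM0] := exists_left_kernel M.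
apply: (apolar_eigenvalue g0); apply: apolar_coef moments _ => i.
by move/rowP/(_ i): gM0; rewrite !mxE; under eq_bigr do rewrite mxE.
Qed.

Lemma waring_decomposition_size k a b lambda s :
  has_waring_decomposition (2 * k) (f_lambda k a b lambda) s -> (k <= s)%N.
Proof.
move=> dec_s; rewrite leqNgt; apply/negP => lt_sk.
have lambdaE := waring_decomposition_eigenvalue (ltnW lt_sk) dec_s.
have [u [v moments]] := waring_moments dec_s.
pose M : 'M_(k.+1, s) := \matrix_(j, i) (u i ^+ j * v i ^+ (k - j)).
(* One more column forces the kernel vector to vanish at [0]. *)
have [|g g0 gMe0] := exists_left_kernel (row_mx M (delta_mx 0 (0 : 'I_1))).
  by rewrite addn1 ltnS.
have /eq_row_mx[gM0 ge0] :
    row_mx (g *m M) (g *m delta_mx 0 (0 : 'I_1)) = row_mx 0 0.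
  by rewrite -mul_mx_row gMe0 row_mx0.
have gE : forall j : 'I_k.+1, g 0 j =
    - ('C(2 * k, k)%:R * lambda * (a ^+ (k - j) * b ^+ j)) *
    \sum_(i < k.+1) g 0 i * (a ^+ i * b ^+ (k - i)).
  apply: apolar_coef moments _ => i.
  by move/rowP/(_ i): gM0; rewrite !mxE; under eq_bigr do rewrite mxE.
have g00 : g 0 0 = 0.
  by move/rowP/(_ 0): ge0; rewrite -colE !mxE.
case/eqP: g0; apply/rowP => j; rewrite gE mxE.
(* Either [g(a, b) = 0], and then every coefficient vanishes, or [C * lambda * a ^+ k = 0], and then
   [lambdaE] reads [0 = 1]. *)
have := gE 0; rewrite g00 subn0 expr0 mulr1 => /esym/eqP.
rewrite mulf_eq0 => /orP[|/eqP->]; last by rewrite mulr0.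
rewrite oppr_eq0 => /eqP Cla0; case/eqP: (oner_neq0 F); rewrite -lambdaE exprMn.
by transitivity (- (k.+1%:R * b ^+ k) * ('C(2 * k, k)%:R * lambda * a ^+ k));
  [ring | rewrite Cla0 mulr0].
Qed.
End LowerBound.

(** * Explicit decompositions from roots of unity *)

Section UpperBound.
Import Num.Theory.
Variable F : numClosedFieldType.
Implicit Types (a b lambda : F) (k r d : nat).

(** In characteristic 0, ['X^n - 1] is separable, so it has [n] distinct roots in [F], and one of
    them is primitive. *)
Lemma prim_root_exists n : (0 < n)%N -> exists z : F, n.-primitive_root z.
Proof.
move=> n_gt0; have [r Dp] := closed_field_poly_normal ('X^n - 1 : {poly F}).
rewrite (monicP _) ?monicXnsubC // scale1r in Dp.
have rn1 : all n.-unity_root r.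
  by apply/allP=> z; rewrite -root_prod_XsubC -Dp.
have sz_r : (n < (size r).+1)%N.
  by rewrite -(size_prod_XsubC r id) -Dp size_XnsubC.
have [|z] := hasP (has_prim_root n_gt0 rn1 _ sz_r); last by exists z.
rewrite -separable_prod_XsubC -Dp separable_Xn_sub_1 //.
by rewrite pnatr_eq0 -lt0n.
Qed.

Lemma sum_prim_root_exp n (z : F) m : n.-primitive_root z ->
  \sum_(i < n) (z ^+ i) ^+ m = if (n %| m)%N then n%:R else 0.
Proof.
move=> prim_z; under eq_bigr do rewrite exprAC.
rewrite (prim_order_dvd prim_z).
have [->|zm1] := eqVneq (z ^+ m) 1.
  by under eq_bigr do rewrite expr1n; rewrite sumr_const card_ord.
(* Geometric sum: its product with [z ^+ m - 1] is [(z ^+ m) ^+ n - 1 = 0]. *)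
have := subrX1 (z ^+ m) n; rewrite exprAC (prim_expr_order prim_z) expr1n.
by move/esym/eqP; rewrite subrr mulf_eq0 subr_eq0 (negPf zm1) => /eqP.
Qed.

Lemma linear_form_homog a b : linear_form a b \is 1.-homog.
Proof. by rewrite rpredD // rpredZ // dhomogX /= mdeg1. Qed.

(** Over an algebraically closed field, a coefficient is absorbed into its linear form through a
    [d]-th root. *)
Lemma has_waring_decomposition_scaled d r (c u v : 'I_r -> F) : (0 < d)%N ->
  has_waring_decomposition d
    (\sum_(i < r) c i *: linear_form (u i) (v i) ^+ d) r.
Proof.
move=> d_gt0; exists (fun i => d.-root (c i) *: linear_form (u i) (v i)).
split=> [i|]; first by rewrite rpredZ // linear_form_homog.
by apply: eq_bigr => i _; rewrite exprZn rootCK.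
Qed.

Lemma exp_sum_scaled (A : comAlgType F) (X Y : A) a b d :
  (a *: X + b *: Y) ^+ d =
  \sum_(j < d.+1) (a ^+ j * b ^+ (d - j)) *+ 'C(d, j) *:
    (X ^+ j * Y ^+ (d - j)).
Proof.
rewrite addrC exprDn; apply: eq_bigr => j _.
rewrite !exprZn -scalerAl -scalerAr scalerA scalerMnl [Y ^+ _ * _]mulrC.
by rewrite [b ^+ _ * _]mulrC.
Qed.

(** Roots-of-unity filter: the [j]-th binomial term is weighted by the sum of the
    [(z ^+ i) ^+ (e + j)]. *)
Lemma sum_prim_root_powers (A : comAlgType F) (X Y : A) n (z : F) e a b d :
  n.-primitive_root z ->
  \sum_(i < n) (z ^+ i) ^+ e *: ((z ^+ i * a) *: X + b *: Y) ^+ d =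
  \sum_(j < d.+1 | (n %| e + j)%N)
    (n%:R * (a ^+ j * b ^+ (d - j) *+ 'C(d, j))) *: (X ^+ j * Y ^+ (d - j)).
Proof.
move=> prim_z; under eq_bigr do rewrite exp_sum_scaled scaler_sumr.
rewrite exchange_big [RHS]big_mkcond; apply: eq_bigr => j _ /=.
have := sum_prim_root_exp (e + j) prim_z.
under [LHS]eq_bigr do rewrite exprD.
set w := a ^+ j * b ^+ (d - j) *+ 'C(d, j) => sumE.
transitivity (((\sum_(i < n) (z ^+ i) ^+ e * (z ^+ i) ^+ j) * w) *:
  (X ^+ j * Y ^+ (d - j))).
  rewrite mulr_suml scaler_suml; apply: eq_bigr => i _; rewrite scalerA.
  by congr (_ *: _); rewrite exprMn -!mulrA -mulrnAr.
by rewrite sumE; case: ifP; rewrite ?mul0r ?scale0r.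
Qed.

(** The filter with [e = 1] isolates the middle monomial. Its form at [i = 0] is [linear_form a b]
    itself, so the added power merges into that summand. *)
Lemma f_lambda_prim_root k (z : F) a b lambda :
  k.+1.-primitive_root z -> a * b != 0 ->
  f_lambda k a b lambda = \sum_(i < k.+1)
    (z ^+ i / (k.+1%:R * 'C(2 * k, k)%:R * (a * b) ^+ k) +
      (i == 0)%:R * lambda) *: linear_form (z ^+ i * a) b ^+ (2 * k).
Proof.
move=> prim_z ab0; set c := _ * _ ^+ k.
have c0 : c != 0.
  by rewrite !mulf_neq0 ?expf_neq0 ?mid_binomial_neq0 ?pnatr_eq0.
under eq_bigr do rewrite scalerDl; rewrite big_split /=; congr (_ + _); last first.
  rewrite big_ord_recl big1 ?addr0 => [|i _].
    by rewrite expr0 !mul1r.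
  by rewrite mul0r scale0r.
have := sum_prim_root_powers (binary_x F) (binary_y F) 1 a b (2 * k) prim_z.
have kP : (k < (2 * k).+1)%N by lia.
(* As [1 <= j + 1 <= 2k + 1], the only possible multiple of [k + 1] is [k + 1] itself. *)
rewrite (big_pred1 (Ordinal kP)) => [|j]; last first.
  have [->|ne_jk] := eqVneq j (Ordinal kP).
    by rewrite /= add1n dvdnn eqxx.
  rewrite /= (negPf ne_jk); apply/negP => /dvdnP[q def_j]; case/eqP: ne_jk; apply: val_inj => /=.
  have := ltn_ord j; case: q def_j => [|[|q]] def_j; nia.
have -> /= : (2 * k - Ordinal kP = k)%N by rewrite /=; lia.
rewrite -[_ * _ *+ 'C(_, _)]mulr_natr -exprMn [_ * 'C(2 * k, k)%:R]mulrC mulrA => /esym sumE.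
apply: (scalerI c0); rewrite {1}/c sumE scaler_sumr; apply: eq_bigr => i _.
by rewrite expr1 scalerA [c * _]mulrC divfK.
Qed.

Lemma waring_decomposition_generic k a b lambda : (0 < k)%N -> a * b != 0 ->
  has_waring_decomposition (2 * k) (f_lambda k a b lambda) k.+1.
Proof.
move=> k_gt0 ab0; have [z prim_z] := prim_root_exists (ltn0Sn k).
rewrite (f_lambda_prim_root lambda prim_z ab0).
by apply: has_waring_decomposition_scaled; lia.
Qed.

Lemma waring_decomposition_special k a b : (0 < k)%N -> a * b != 0 ->
  has_waring_decomposition (2 * k)
    (f_lambda k a b (- (k.+1%:R * 'C(2 * k, k)%:R * (a * b) ^+ k)^-1)) k.
Proof.
move=> k_gt0 ab0; have [z prim_z] := prim_root_exists (ltn0Sn k).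
rewrite (f_lambda_prim_root _ prim_z ab0) big_ord_recl /=.
rewrite !mul1r subrr scale0r add0r.
by apply: has_waring_decomposition_scaled; lia.
Qed.

(** The filter of order [k] keeps [j = 0], [k] and [2k]; one extra power of [Y] removes the term
    [j = 0]. Abstract [X] and [Y] allow the two variables to be swapped. *)
Lemma monomial_add_power (A : comAlgType F) (X Y : A) k lambda :
  (0 < k)%N -> lambda != 0 ->
  exists c u v : 'I_k.+1 -> F,
    X ^+ k * Y ^+ k + lambda *: X ^+ (2 * k) =
    \sum_(i < k.+1) c i *: (u i *: X + v i *: Y) ^+ (2 * k).
Proof.
move=> k_gt0 lambda0; have [z prim_z] := prim_root_exists k_gt0.
set C : F := 'C(2 * k, k)%:R; have C0 : C != 0 by apply: mid_binomial_neq0.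
have k0 : k%:R != 0 :> F by rewrite pnatr_eq0 -lt0n.
(* The coefficients of [X^(2k)] and [X^k Y^k] in the filtered sum have ratio [s ^+ k / C], which
   must be [lambda]; [c] then normalizes the latter to 1. *)
pose s := k.-root (C * lambda).
have sE : s ^+ k = C * lambda by rewrite rootCK.
pose c := (k%:R * C * s ^+ k)^-1.
exists (fun i => if unlift 0 i is Some _ then c else - (k%:R * c)).
exists (fun i => if unlift 0 i is Some j then z ^+ j * s else 0).
exists (fun=> 1).
rewrite big_ord_recl unlift_none; under eq_bigr do rewrite liftK.
rewrite scale0r add0r scale1r -scaler_sumr.
have := sum_prim_root_powers X Y 0 s 1 (2 * k) prim_z.
under eq_bigr do rewrite expr0 scale1r.
rewrite scale1r => ->.
have P0 : (0 < (2 * k).+1)%N by [].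
have P1 : (k < (2 * k).+1)%N by lia.
have P2 : (2 * k < (2 * k).+1)%N by lia.
rewrite (bigD1 (Ordinal P0)) ?dvdn0 //=.
rewrite (bigD1 (Ordinal P1)) ?dvdnn -?val_eqE /=; last lia.
rewrite (bigD1 (Ordinal P2)) /=; last first.
  by rewrite -!val_eqE /= add0n dvdn_mull //; lia.
rewrite big1 ?addr0 => [|j]; last first.
  rewrite -!val_eqE /= add0n -!andbA => /and4P[/dvdnP[q def_j] jn0 jnk jn2k].
  by have := ltn_ord j; case: q def_j => [|[|[|q]]]; nia.
have -> : (2 * k - k = k)%N by lia.
rewrite subn0 subnn !expr0 !expr1n !mulr1 mul1r !scalerDr !scalerA bin0 binn.
rewrite addrA -scalerDl mulr1 [c * k%:R]mulrC addNr scale0r add0r.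
have s0 : s ^+ k != 0 by rewrite sE mulf_neq0.
have -> : c * (k%:R * (s ^+ k *+ 'C(2 * k, k))) = 1.
  by rewrite -[s ^+ k *+ _]mulr_natr /c -/C; field; rewrite s0 C0.
have -> : c * (k%:R * (s ^+ (2 * k) *+ 1)) = lambda.
  rewrite mulr1n mul2n -addnn exprD /c sE; field.
  by rewrite C0 k0 lambda0.
by rewrite scale1r.
Qed.

Lemma waring_decomposition_axis k a b lambda : (0 < k)%N -> lambda != 0 ->
  a * b = 0 ->
  has_waring_decomposition (2 * k) (f_lambda k a b lambda) k.+1.
Proof.
move=> k_gt0 lambda0 /eqP; rewrite mulf_eq0 => ab0.
have k2_gt0 : (0 < 2 * k)%N by lia.
have [->|b0] := eqVneq b 0; last first.
  have -> : a = 0 by case/orP: ab0 => /eqP // b00; rewrite b00 eqxx in b0.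
  have lb0 : lambda * b ^+ (2 * k) != 0 by rewrite mulf_neq0 ?expf_neq0.
  have [c [u [v]]] := monomial_add_power (binary_y F) (binary_x F) k_gt0 lb0.
  rewrite mulrC -scalerA -exprZn => fE.
  rewrite /f_lambda /linear_form scale0r add0r fE.
  under eq_bigr do rewrite addrC; exact: has_waring_decomposition_scaled.
have [->|a0] := eqVneq a 0.
  (* The form is now the bare monomial: the generic case with [lambda = 0] and any [a * b != 0],
     here [a = b = 1]. *)
  have := @waring_decomposition_generic k 1 1 0 k_gt0.
  rewrite mulr1 => /(_ (oner_neq0 _)); rewrite /f_lambda /linear_form.
  by rewrite !scale0r !addr0 expr0n gtn_eqF // scaler0 addr0.
have la0 : lambda * a ^+ (2 * k) != 0 by rewrite mulf_neq0 ?expf_neq0.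
have [c [u [v]]] := monomial_add_power (binary_x F) (binary_y F) k_gt0 la0.
rewrite -scalerA -exprZn => fE.
rewrite /f_lambda /linear_form scale0r addr0 fE.
exact: has_waring_decomposition_scaled.
Qed.
End UpperBound.

(** * Determination of the rank from the two bounds *)

Theorem theorem3p4 (R : realType) (k : nat) (hk : (2 <= k)%N) (a b : R[i]) :
  (a * b != 0 ->
     exists! lambda0 : R[i],
       lambda0 != 0 /\
       forall lambda : R[i], lambda != 0 ->
         (lambda = lambda0 ->
            has_waring_rank (2 * k) (f_lambda k a b lambda) k) /\
         (lambda != lambda0 ->
            has_waring_rank (2 * k) (f_lambda k a b lambda) k.+1)) /\
  (a * b = 0 ->
     forall lambda : R[i], lambda != 0 ->
       has_waring_rank (2 * k) (f_lambda k a b lambda) k.+1).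
Proof.
have k_gt0 : (0 < k)%N by apply: ltnW.
split=> [ab0|ab0 lambda lambda0]; last first.
  split=> [|s dec_s]; first exact: waring_decomposition_axis.
  rewrite ltnNge; apply/negP => le_sk.
  have := waring_decomposition_eigenvalue le_sk dec_s.
  rewrite ab0 expr0n gtn_eqF // !mulr0 => /esym/eqP.
  by rewrite oner_eq0.
set c := k.+1%:R * 'C(2 * k, k)%:R * (a * b) ^+ k.
have c0 : c != 0.
  by rewrite !mulf_neq0 ?expf_neq0 ?mid_binomial_neq0 ?Num.Theory.pnatr_eq0.
have rank_special : has_waring_rank (2 * k) (f_lambda k a b (- c^-1)) k.
  split; first exact: waring_decomposition_special.
  by move=> s; apply: waring_decomposition_size.
exists (- c^-1); split.
  split=> [|lambda lambda0]; first by rewrite oppr_eq0 invr_eq0.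
  split=> [->//|ne_lambda]; split=> [|s dec_s].
    exact: waring_decomposition_generic.
  rewrite ltnNge; apply/negP => le_sk.
  have := waring_decomposition_eigenvalue le_sk dec_s.
  move/(canRL (mulfK c0)); rewrite mul1r => /(canRL opprK) lambdaE.
  by rewrite lambdaE eqxx in ne_lambda.
(* Uniqueness: another [mu] would force rank [k.+1] at [- c^-1], where [k] powers suffice. *)
move=> mu [mu0 rank_mu]; apply/eqP/negP => /negP ne_mu.
have nz : - c^-1 != 0 by rewrite oppr_eq0 invr_eq0.
have [_ min_rank] := (rank_mu _ nz).2 ne_mu.
by have := min_rank _ rank_special.1; rewrite ltnn.
Qed.
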